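(* Let $n\geq 3$ be an integer, let $p\in\mathbb{R}$ and let $\theta>0$. Then $$\frac{\sqrt{p^2+\theta^2\,\bar{X}\,\bar{X}_{-1}}-p}{\theta\,\bar{X}_{-1}}$$ is the maximum likelihood estimator (MLE) of the scale parameter $\eta$ in a scale family $\left\{\frac{1}{\eta}f(x/\eta),\ \eta>0\right\}$ of densities on $(0,\infty)$ for all samples $X_1,\ldots,X_n$ of fixed sample size $n$ if and only if there exists $d>0$ such that the family is $\{f_{pd,\theta d,\eta}(x),\ \eta>0\}$, i.e. the family of densities of the distributions $\mathrm{GIG}(pd,\theta d/\eta,\theta\eta d)$, $\eta>0$.
   Context: For a sample $X_1,\ldots,X_n$ of positive observations, $\bar{X}=\frac{1}{n}\sum_{i=1}^n X_i$ and $\bar{X}_{-1}=\frac{1}{n}\sum_{i=1}^n\frac{1}{X_i}$. $K_q$ denotes the modified Bessel function of the third kind, $K_q(z)=2^{-q-1}z^{q}\int_0^\infty x^{-q-1}e^{-x-\frac{z^2}{4x}}\,dx$ for $z>0$. For $q\in\mathbb{R}$, $a>0$, $b>0$, the Generalized Inverse Gaussian distribution $\mathrm{GIG}(q,a,b)$ is the distribution on $(0,\infty)$ with density $$f_{q,a,b}(x)=\frac{(a/b)^{q/2}}{2K_q(\sqrt{ab})}\,x^{q-1}e^{-(ax+b/x)/2},\quad x>0.$$ In the alternative parametrization $\theta=\sqrt{ab}$, $\eta=\sqrt{b/a}$, which is the one used for $f_{pd,\theta d,\eta}$ in the claim, the density is written $$f_{q,\theta,\eta}(x)=\frac{1}{2\eta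 K_q(\theta)}\left(\frac{x}{\eta}\right)^{q-1}e^{-\theta(x/\eta+\eta/x)/2},\quad x>0,$$ with $q\in\mathbb{R}$, $\theta>0$, $\eta>0$. *)

(* Defs.v *)
From HB Require Import structures.
From mathcomp Require Import all_boot all_order all_algebra.
From mathcomp Require Import all_classical all_reals all_analysis.

Set Implicit Arguments.
Unset Strict Implicit.
Unset Printing Implicit Defensive.

Import Order.TTheory GRing.Theory Num.Theory.
Import numFieldNormedType.Exports.

Local Open Scope classical_set_scope.
Local Open Scope ring_scope.

Section Defs.
Variable R : realType.
Implicit Types (n : nat) (p q a b z x theta eta : R) (f : R -> R).

Definition sample_mean n (X : 'I_n -> R) : R :=
  n%:R^-1 * \sum_(i < n) X i.

Definition sample_mean_inv n (X : 'I_n -> R) : R :=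
  n%:R^-1 * \sum_(i < n) (X i)^-1.

(* Modified Bessel function of the third kind; meaningful for 0 < z.
   The integral is a Lebesgue integral. *)
Definition besselK q z : R :=
  2 `^ (- q - 1) * z `^ q *
  \int[lebesgue_measure]_(x in `]0%R, +oo[)
    (x `^ (- q - 1) * expR (- x - z ^+ 2 / (4 * x))).

Definition gig_density q a b x : R :=
  (a / b) `^ (q / 2) / (2 * besselK q (Num.sqrt (a * b)))
  * x `^ (q - 1) * expR (- ((a * x + b / x) / 2)).

(* Alternative parametrization: theta = sqrt (a * b), eta = sqrt (b / a). *)
Definition gig_density_scale q theta eta x : R :=
  (2 * eta * besselK q theta)^-1 * (x / eta) `^ (q - 1)
  * expR (- (theta * (x / eta + eta / x) / 2)).

(* Only the values of f on the open half-line matter, here and below. *)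
Definition is_density_pos f : Prop :=
  [/\ measurable_fun (`]0, +oo[ : set R) f,
      (forall x, 0 < x -> 0 <= f x) &
      (\int[lebesgue_measure]_(x in `]0%R, +oo[) (f x)%:E = 1)%E].

(* A parametric family is a function of the parameter, then of the point. *)
Definition scale_family f : R -> R -> R := fun eta x => eta^-1 * f (x / eta).

Definition likelihood n (F : R -> R -> R) (X : 'I_n -> R) eta : R :=
  \prod_(i < n) F eta (X i).

(* T is the MLE of the parameter eta > 0: for every sample of size n in the
   open half-line, T X is the (unique) global maximizer of the likelihood. *)
Definition is_MLE n (F : R -> R -> R) (T : ('I_n -> R) -> R) : Prop :=
  forall X : 'I_n -> R, (forall i, 0 < X i) ->
    0 < T X /\
    forall eta, 0 < eta -> eta != T X ->
      likelihood F X eta < likelihood F X (T X).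

(* Equality as families indexed by the scale parameter; this is finer than
   equality of the underlying sets of densities, which would not determine
   the scale of f and hence would not determine the MLE. *)
Definition same_family (F G : R -> R -> R) : Prop :=
  forall eta x, 0 < eta -> 0 < x -> F eta x = G eta x.

Definition gig_estimator n p theta (X : 'I_n -> R) : R :=
  (Num.sqrt (p ^+ 2 + theta ^+ 2 * sample_mean X * sample_mean_inv X) - p)
  / (theta * sample_mean_inv X).

End Defs.

(* Main.v *)
Require Import Defs.
From HB Require Import structures.
From mathcomp Require Import all_boot all_order all_algebra.
From mathcomp Require Import ring lra.
From mathcomp Require Import all_classical all_reals all_analysis.
From mathcomp Require Import measurable_realfun.

Set Implicit Arguments.
Unset Strict Implicit.
Unset Printing Implicit Defensive.

Import Order.TTheory GRing.Theory Num.Theory.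
Import numFieldNormedType.Exports.

Local Open Scope classical_set_scope.
Local Open Scope ring_scope.

(** Put c = p / theta and, for a positive f, G u = ln (f (expR u)) + u.  In the
variable u = ln x a change of scale is a translation, and the estimator takes
the value expR tau on the sample expR u_1, ..., expR u_n exactly when the
scores expR v - expR (- v) - 2 c at the points v = u_i - tau add up to 0.
Hence (lemma is_MLE_scale_family) the estimator is the MLE of the scale if and
only if G is shift maximal: as soon as the scores of the u_i add up to 0, the
sum of the G (u_i + t) is strictly maximal at t = 0.

The function Phi u = expR u + expR (- u) - 2 c u is a primitive of the score.
If G = C - a Phi with a > 0, strict convexity of Phi gives shift maximality
(score_primitive_maximal); such a G is, up to a constant, the logarithm of the
density of ln X for a GIG variable X.  The content of the theorem is the
converse, shift_maximal_shape; all the regularity of G that it needs is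
extracted from the inequalities that shift maximality provides.

Take two points b < a.  For a small step t > 0, the other observations can be
chosen so that the scores are balanced both when the first observation is a
and, after a translation of the others by t, when it is b + t.  This asks for
two numbers with given sum and given sum of inverses (sum_and_inv_sum).  Adding
the two resulting inequalities leaves G (a + t) - G a <= G (b + t) - G b, and
summing over small steps gives the inequality for every t >= 0
(increment_nonincreasing).  This concavity property is strong enough for the
dyadic right derivative D of G to exist and to be nonincreasing.

Shift maximality then says that the sum of the D u_i is nonpositive when the
scores add up to 0, and nonnegative when they add up to a negative number.  For
a sample of size at least 3 these two signs force D, as a function of the
score, to be linear (sum_sign_linear).  So D is minus a constant times the
score, and integrating back gives G = C - a Phi.

The multiplicative constant is finally identified by the integral of f being 1:
the substitution x = r ^ 2 / y turns the integral that defines the Bessel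
function into the integral of the GIG kernel (besselK_gig_kernel). *)

(** * Functions whose sums have the sign opposite to the sum of the arguments *)

(** Samples that prescribe three observations and leave the others at a default
value; this is where a sample size of at least 3 enters. *)
Lemma sum_three (V : zmodType) (T : Type) (m : nat) (h : T -> V) (a b c z : T) :
  \sum_(i < m.+3) h (nth z [:: a; b; c] i) = h a + h b + h c + h z *+ m.
Proof.
rewrite !big_ord_recl /= !addrA; congr (_ + _).
rewrite (eq_bigr (fun=> h z)) ?sumr_const ?card_ord // => i _.
by rewrite /= nth_nil.
Qed.

Section linear.
Variables (R : realType) (m : nat) (P : R -> R).
Hypothesis P_ni : {homo P : x y /~ x <= y}.
Hypothesis P_sum0 :
  forall v : 'I_m.+3 -> R, \sum_i v i = 0 -> \sum_i P (v i) <= 0.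
Hypothesis P_sum_lt0 :
  forall v : 'I_m.+3 -> R, \sum_i v i < 0 -> 0 <= \sum_i P (v i).

(** Compare the samples x, w, - x - w and y, v, - x - w, completed by zeros: the
first one has sum 0, the second one a negative sum. *)
Let drop_lt x y v w : y - x < w - v -> P x - P y <= P v - P w.
Proof.
move=> H.
have := P_sum0 (v := fun i => nth 0 [:: x; w; - x - w] i).
have := P_sum_lt0 (v := fun i => nth 0 [:: y; v; - x - w] i).
rewrite !(sum_three m P) !(sum_three m id) mul0rn /=.
move=> /(_ ltac:(lra)) h1 /(_ ltac:(lra)) h2; lra.
Qed.

Let drop_mul k x e y : 0 <= e ->
  (forall j, (j < k)%N -> P x - P y <= P (e * j%:R) - P (e * j.+1%:R)) ->
  (P x - P y) * k%:R <= P 0 - P (e * k%:R).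
Proof.
move=> e0; elim: k => [|k IH] H; first by rewrite !mulr0 subrr.
have := H k (ltnSn k); have {IH} := IH (fun j jk => H j (ltnW jk)).
rewrite -[k.+1%:R]natr1; lra.
Qed.

(** The interval from 0 to 1 contains k + 1 intervals longer than y - x. *)
Let drop_small (k : nat) x y : y - x < k.+1%:R^-1 ->
  P x - P y <= (P 0 - P 1) / k.+1%:R.
Proof.
move=> H; rewrite ler_pdivlMr ?ltr0Sn //.
have := @drop_mul k.+1 x k.+1%:R^-1 y.
rewrite mulVf ?pnatr_eq0 //; apply; first by rewrite invr_ge0.
move=> j _; apply: drop_lt.
by rewrite -mulrBr -[j.+1%:R]natr1 (addrC j%:R) addrK mulr1.
Qed.

(** The drop of P over an interval shorter than 1 / k is O(1 / k), so the strict
inequality between the lengths in drop_lt can be relaxed by continuity. *)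
Let drop_le x y v w : y - x <= w - v -> P x - P y <= P v - P w.
Proof.
move=> H; rewrite -[leRHS]addr0; apply/ler_addgt0Pr => e e0.
have [k Hk] : exists k : nat, (P 0 - P 1) / e < k.+1%:R.
  by exists (Num.truncn ((P 0 - P 1) / e)); exact: truncnS_gt.
have d_lt : (P 0 - P 1) / k.+1%:R < e.
  by rewrite ltr_pdivrMr ?ltr0Sn // mulrC -ltr_pdivrMr.
have : 0 < k.+2%:R^-1 :> R by rewrite invr_gt0.
set e2 := k.+2%:R^-1 => k2.
have h1 : P x - P y <= P v - P (w + e2) by apply: drop_lt; lra.
have h2 : P w - P (w + e2) <= (P 0 - P 1) / k.+1%:R.
  by apply: drop_small; rewrite addrC addKr ltf_pV2 ?posrE ?ltr0Sn // ltr_nat.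
move: h1 (le_lt_trans h2 d_lt); lra.
Qed.

Let drop_eq x y v w : y - x = w - v -> P x - P y = P v - P w.
Proof. by move=> H; apply/le_anti/andP; split; apply: drop_le; lra. Qed.

Let drop_muln x k : P 0 - P (x * k%:R) = (P 0 - P x) * k%:R.
Proof.
elim: k => [|k IH]; first by rewrite !mulr0 subrr.
have := @drop_eq 0 x (x * k%:R) (x * k.+1%:R).
rewrite -!natr1 => /(_ ltac:(lra)); move: IH; lra.
Qed.

(** By drop_eq the drop of P over an interval depends only on its length; it is
additive and monotone in the length, hence proportional to it. *)
Lemma sum_sign_linear : exists2 d, 0 <= d & forall v, P v = - (d * v).
Proof.
have P00 : P 0 = 0.
  have : (P 0) *+ m.+3 <= 0.
    have := @P_sum0 (fun=> 0); rewrite !sumr_const card_ord mul0rn; exact.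
  have : 0 <= (P 0) *+ m.+3.
    have h k : 0 <= (P (- k.+1%:R^-1)) *+ m.+3.
      have := @P_sum_lt0 (fun=> - k.+1%:R^-1).
      rewrite !sumr_const card_ord; apply.
      by rewrite mulNrn oppr_lt0 pmulrn_lgt0.
    have h' k : - ((P 0 - P 1) / k.+1%:R) <= P 0.
      have h1 : P (- k.+2%:R^-1) - P 0 <= (P 0 - P 1) / k.+1%:R.
        by apply: drop_small; rewrite sub0r opprK ltf_pV2 ?posrE ?ltr0Sn // ltr_nat.
      have := h k.+1; rewrite pmulrn_lge0 //.
      by move: h1; set B := (_ / _); set Q := P (- _); lra.
    rewrite pmulrn_lge0 //; apply/ler_addgt0Pr => e e0.
    have [k Hk] : exists k : nat, (P 0 - P 1) / e < k.+1%:R.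
      by exists (Num.truncn ((P 0 - P 1) / e)); exact: truncnS_gt.
    have : (P 0 - P 1) / k.+1%:R < e.
      by rewrite ltr_pdivrMr ?ltr0Sn // mulrC -ltr_pdivrMr.
    by have := h' k; set B := (_ / _); lra.
  rewrite pmulrn_lge0 // pmulrn_lle0 // => h1 h2; exact/le_anti/andP.
set d := - P 1.
have d0 : 0 <= d by rewrite oppr_ge0 -P00; apply: P_ni.
have PN v : P (- v) = - P v.
  by have := @drop_eq (- v) 0 0 v ltac:(lra); rewrite P00; lra.
have pos v : 0 <= v -> P v = - (d * v).
  move=> v0; apply/eqP; rewrite -subr_eq0 -normr_le0.
  apply/ler_addgt0Pr => e e0; rewrite add0r.
  have [k Hk] : exists k : nat, d / e < k.+1%:R.
    by exists (Num.truncn (d / e)); exact: truncnS_gt.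
  have {Hk} dk : d < e * k.+1%:R by rewrite mulrC -ltr_pdivrMr.
  have kp : 0 < k.+1%:R :> R by [].
  have Ek := drop_muln v k.+1; rewrite P00 in Ek.
  move: (k.+1%:R) dk kp Ek => K dk kp Ek.
  (* v lies between q / K and (q + 1) / K, where P is known. *)
  have /andP[q1 q2] := truncn_itv (mulr_ge0 v0 (ltW kp)).
  move: (Num.truncn _) q1 q2 => q q1 q2.
  have E1 := drop_muln 1 q; have E2 := drop_muln 1 q.+1.
  have b1 := P_ni q1; have b2 := P_ni (ltW q2).
  have dq1 : d * q%:R <= d * (v * K) by rewrite ler_wpM2l.
  have dq2 : d * (v * K) <= d * q.+1%:R by rewrite ler_wpM2l // ltW.
  rewrite -natr1 !mul1r P00 in E1 E2 b2 dq2.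
  rewrite -(ler_pM2r kp) -[X in _ * X <= _](gtr0_norm kp) -normrM ler_norml.
  move: Ek E1 E2 b1 b2 dq1 dq2 dk; rewrite /d.
  set P1 := P (v * K); set P2 := P (q%:R); set P3 := P (q%:R + 1).
  by move=> *; apply/andP; split; lra.
exists d => // v; have [v0|v0] := leP 0 v; first exact: pos.
by rewrite -[v]opprK PN pos ?mulrN ?opprK // oppr_ge0 ltW.
Qed.

End linear.

(** * The score *)

(** Up to a positive factor, the derivative at u of minus the logarithm of the
density of ln X, for X with a GIG distribution of scale 1. *)
Definition score (R : realType) (c u : R) : R := expR u - expR (- u) - 2 * c.

Lemma score_le (R : realType) (c : R) : {mono score c : x y / x <= y}.
Proof.
apply: le_mono => x y xy; rewrite /score ltrD2r ltrD ?ltr_expR // ltrN2.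
by rewrite ltr_expR ltrN2.
Qed.

(** With x = expR u, solving x - 1 / x = w is solving x ^ 2 - w x - 1 = 0 for its
positive root. *)
Lemma score_bij (R : realType) (c : R) : exists2 L : R -> R,
  cancel L (score c) & cancel (score c) L.
Proof.
pose L v := ln (((v + 2 * c) + Num.sqrt ((v + 2 * c) ^+ 2 + 4)) / 2).
have LK : cancel L (score c).
  move=> v; rewrite /score /L; set w := v + 2 * c.
  have w4 : 0 <= w ^+ 2 + 4 by rewrite addr_ge0 // sqr_ge0.
  have s2 := sqr_sqrtr w4; have s0 := sqrtr_ge0 (w ^+ 2 + 4).
  have x0 : 0 < (w + Num.sqrt (w ^+ 2 + 4)) / 2.
    rewrite divr_gt0 //.
    suff : `|w| < Num.sqrt (w ^+ 2 + 4) by rewrite ltr_norml => /andP[]; lra.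
    by rewrite -sqrtr_sqr ltr_sqrt ?ltrDl // ltr_wpDl // sqr_ge0.
  rewrite expRN lnK ?posrE //; move: (Num.sqrt _) s0 s2 x0 => s s0 s2 x0.
  have -> : ((w + s) / 2)^-1 = (s - w) / 2.
    have xy : ((w + s) / 2) * ((s - w) / 2) = 1.
      have -> : ((w + s) / 2) * ((s - w) / 2) = (s ^+ 2 - w ^+ 2) / 4 by field.
      by rewrite s2; field.
    by apply: (mulfI (lt0r_neq0 x0)); rewrite xy mulfV // lt0r_neq0.
  by rewrite /w; field.
exists L => // u; apply: (inc_inj (@score_le _ c)); exact: LK.
Qed.

Definition shift_maximal (R : realType) (n : nat) (c : R) (G : R -> R) :=
  forall (u : 'I_n -> R) (t : R), \sum_i score c (u i) = 0 -> t != 0 ->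
    \sum_i G (u i + t) < \sum_i G (u i).

(** * Concavity of shift maximal functions *)

(** The two numbers are the roots of T ^ 2 - A T + A / B, whose discriminant is
nonnegative because A B >= 4. *)
Lemma sum_and_inv_sum (R : rcfType) (A B : R) : 2 <= A -> 2 <= B ->
  exists2 xy : R * R, 0 < xy.1 /\ 0 < xy.2 &
    xy.1 + xy.2 = A /\ xy.1^-1 + xy.2^-1 = B.
Proof.
move=> A2 B2; have A0 : 0 < A by lra.
have B0 : 0 < B by lra.
have q0 : 0 < A / B by rewrite divr_gt0.
have disc : 0 <= A ^+ 2 - 4 * (A / B).
  suff -> : A ^+ 2 - 4 * (A / B) = A / B * (A * B - 4).
    by rewrite mulr_ge0 ?(ltW q0) //; nra.
  by field; rewrite gt_eqF.
have s2 := sqr_sqrtr disc; have s0 := sqrtr_ge0 (A ^+ 2 - 4 * (A / B)).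
move: (Num.sqrt _) s0 s2 => s s0 s2.
have sA : s < A by rewrite -(@ltr_pXn2r _ 2) ?nnegrE // ?(ltW A0) // s2; lra.
have x0 : 0 < (A + s) / 2 by lra.
have y0 : 0 < (A - s) / 2 by lra.
exists ((A + s) / 2, (A - s) / 2) => //=; split; first by lra.
have xy : ((A + s) / 2) * ((A - s) / 2) = A / B.
  have -> : ((A + s) / 2) * ((A - s) / 2) = (A ^+ 2 - s ^+ 2) / 4 by field.
  by rewrite s2; field; rewrite gt_eqF.
have -> : B = ((A + s) / 2 + (A - s) / 2) / (A / B).
  by field; rewrite !gt_eqF.
by rewrite -xy; field; rewrite !gt_eqF //; lra.
Qed.

Section concavity.
Variables (R : realType) (m : nat) (c : R) (G : R -> R).
Hypothesis G_max : shift_maximal m.+3 c G.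

Let n : R := m%:R + 3.

(** Two samples share all observations but the first, up to a translation by t:
the samples a, ln x, ln y, 0, ..., 0 and b + t, ln x + t, ln y + t, t, ..., t.
Translating the former by t and the latter by - t and adding the inequalities
cancels all shared terms.  The hypothesis bounds t from above, so that x and y
with both scores balanced exist. *)
Let increment_lag (a b t : R) : b < a -> 0 < t ->
  (expR t ^+ 2 - 1) * (m%:R + 2 + 4 * (n * `|c|) + 2 * expR a + (expR a)^-1)
    <= expR a - expR b ->
  G (a + t) - G a <= G (b + t) - G b.
Proof.
rewrite -ltr_expR -expR_gt1 => ba s1 H.
have a0 := expR_gt0 a; have b0 := expR_gt0 b.
have n0 : 0 <= n by rewrite addr_ge0.
move Eal : (expR a) ba a0 H => al ba a0 H.
move Ebe : (expR b) ba b0 H => be ba b0 H.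
move Es : (expR t) s1 H => s s1 H.
have s2 : 0 < s ^+ 2 - 1 by nra.
(* M is the value that balancing both samples imposes on x + y + m, and M - K
   the one it imposes on 1 / x + 1 / y + m. *)
pose M := (2 * n * c * (s - 1) - s ^+ 2 * be + al + be^-1 - al^-1) / (s ^+ 2 - 1).
have MK : M * (s ^+ 2 - 1) = 2 * n * c * (s - 1) - s ^+ 2 * be + al + be^-1 - al^-1.
  by rewrite /M divfK // gt_eqF.
have nc : - (n * `|c|) <= n * c <= n * `|c|.
  by rewrite -ler_norml normrM (ger0_norm n0).
have M_ge : m%:R + 2 + 2 * (n * `|c|) + al + al^-1 <= M.
  rewrite /M ler_pdivlMr //.
  have ab : al^-1 <= be^-1 by rewrite lef_pV2 ?posrE // ltW.
  move: H nc ab; set k := n * c; set k' := n * `|c|; set p := m%:R; set ai := al^-1.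
  have -> : 2 * n * c = 2 * k by rewrite /k; ring.
  move=> H /andP[nc1 nc2] ab.
  have h1 : 0 <= (k + k') * (s - 1) by apply: mulr_ge0; lra.
  have h2 : 0 <= (al - be) * (s ^+ 2 - 1) by apply: mulr_ge0; lra.
  have h3 : 0 <= k' * ((s ^+ 2 - 1) - (s - 1)) by apply: mulr_ge0; nra.
  nra.
pose K := 2 * n * c - al + al^-1.
have ai0 : 0 < al^-1 by rewrite invr_gt0.
have nc0 : 0 <= n * `|c| by rewrite mulr_ge0.
have A2 : 2 <= M - m%:R by lra.
have B2 : 2 <= M - K - m%:R.
  rewrite /K; move: nc M_ge; rewrite -mulrA; set k := n * c; set k' := n * `|c|.
  by move=> /andP[]; lra.
have [[x y]/= [x0 y0] [xyA xyB]] := sum_and_inv_sum A2 B2.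
have sn0 : s != 0 by rewrite gt_eqF //; lra.
have t0 : t != 0 by apply: contra_neq sn0 => t0; move: Es s1; rewrite t0 expR0; lra.
have := @G_max (fun i => nth 0 [:: a; ln x; ln y] i) t.
rewrite (sum_three m (score c)) (sum_three m (fun v => G (v + t))) (sum_three m G).
have -> : score c a + score c (ln x) + score c (ln y) + score c 0 *+ m = 0.
  rewrite /score !expRN expR0 invr1 !lnK ?posrE // Eal.
  have -> : x - x^-1 = M - m%:R - y - (M - K - m%:R - y^-1) by lra.
  by rewrite -[_ *+ m]mulr_natr /K /n; ring.
move=> /(_ erefl t0).
have := @G_max (fun i => nth t [:: b + t; ln x + t; ln y + t] i) (- t).
rewrite (sum_three m (score c)) (sum_three m (fun v => G (v - t))) (sum_three m G).
have -> : score c (b + t) + score c (ln x + t) + score c (ln y + t)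
    + score c t *+ m = 0.
  rewrite /score !expRN !expRD !lnK ?posrE // Ebe Es -[_ *+ m]mulr_natr !invfM.
  have [-> ->] : x^-1 = M - K - m%:R - y^-1 /\ x = M - m%:R - y by split; lra.
  transitivity (s^-1 * (M * (s ^+ 2 - 1) + s ^+ 2 * be - be^-1 + K - 2 * n * c * s)).
    by rewrite /n; field; rewrite sn0 !gt_eqF.
  by rewrite MK /K; ring.
rewrite oppr_eq0 !addrK subrr add0r => /(_ erefl t0).
lra.
Qed.

(** Cut the translation by s into N steps of length t so small that the
hypothesis of increment_lag holds along the whole way from a to a + s. *)
Lemma increment_nonincreasing (a b s : R) : b <= a -> 0 <= s ->
  G (a + s) - G a <= G (b + s) - G b.
Proof.
rewrite le_eqVlt => /predU1P[->//|ba].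
rewrite le_eqVlt => /predU1P[<-|s0]; first by rewrite !addr0 !subrr.
(* k bounds the second factor of that hypothesis at every point of the way. *)
pose k := m%:R + 2 + 4 * (n * `|c|) + 2 * expR (a + s) + (expR a)^-1.
have k0 : 0 < k.
  rewrite /k ltr_wpDr ?invr_ge0 ?expR_ge0 // ltr_wpDl ?mulr_gt0 ?expR_gt0 //.
  by rewrite !addr_ge0 ?mulr_ge0 // /n addr_ge0.
have d0 : 0 < (expR a - expR b) / k by rewrite divr_gt0 // subr_gt0 ltr_expR.
have l0 : 0 < ln (1 + (expR a - expR b) / k) by rewrite ln_gt0 // ltrDl.
have := truncnS_gt (2 * s / ln (1 + (expR a - expR b) / k)).
set N := (Num.truncn _).+1 => HN.
have N0 : 0 < N%:R :> R by rewrite ltr0Sn.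
pose t := s / N%:R; have t0 : 0 < t by rewrite divr_gt0.
have tN : t * N%:R = s by rewrite divfK // gt_eqF.
have t_small : (expR t ^+ 2 - 1) * k <= expR a - expR b.
  rewrite -ler_pdivlMr // lerBlDl -expRM_natl -[leRHS]lnK ?posrE ?addr_gt0 //.
  rewrite ler_expR ltW // mulrA ltr_pdivrMr //.
  by rewrite [ltRHS]mulrC -ltr_pdivrMr.
have ind j : t * j%:R <= s -> G (a + t * j%:R) - G a <= G (b + t * j%:R) - G b.
  elim: j => [|j IH]; first by rewrite !mulr0 !addr0 !subrr.
  rewrite -natr1 mulrDr mulr1 !addrA => js.
  have := IH ltac:(lra).
  have tj0 : 0 <= t * j%:R by rewrite mulr_ge0 // ltW.
  suff : G (a + t * j%:R + t) - G (a + t * j%:R)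
      <= G (b + t * j%:R + t) - G (b + t * j%:R) by lra.
  apply: increment_lag => //; first by rewrite ltrD2r.
  apply: (@le_trans _ _ ((expR t ^+ 2 - 1) * k)).
    rewrite ler_wpM2l //.
      by rewrite subr_ge0 expr_ge1 ?expR_ge0 // ltW // expR_gt1.
    rewrite /k lerD // ?lerD // ?ler_pM2l // ?ler_expR ?lerD2l //.
      by rewrite (le_trans _ js) // lerDl ltW.
    by rewrite lef_pV2 ?posrE ?expR_gt0 // ler_expR lerDl.
  apply: (le_trans t_small); rewrite ![expR (_ + t * _)]expRD -mulrBl.
  rewrite ler_peMr ?subr_ge0 ?ler_expR ?(ltW ba) //.
  by rewrite -[leLHS]expR0 ler_expR.
by rewrite -tN; apply: ind; rewrite tN.
Qed.

End concavity.

(** * Shape of shift maximal functions *)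

Section dyadic.
Variable R : realType.

Definition dyadic (k : nat) : R := 2 ^- k.

Lemma dyadic_gt0 k : 0 < dyadic k.
Proof. by rewrite invr_gt0 exprn_gt0. Qed.

Lemma dyadic_mul k : dyadic k * 2 ^+ k = 1.
Proof. by rewrite mulVf // expf_neq0. Qed.

Lemma dyadicS k : dyadic k = dyadic k.+1 + dyadic k.+1.
Proof. by rewrite /dyadic exprS; field; rewrite expf_neq0. Qed.

Lemma near_dyadic_le (e : R) : 0 < e -> \forall k \near \oo, dyadic k <= e.
Proof.
move=> e0; near=> k; apply: ltW; rewrite /dyadic -div1r.
by near: k; exact: (near_infty_natSinv_expn_lt (PosNum e0)).
Unshelve. all: by end_near. Qed.

Lemma le_dyadic_eq0 (x C : R) : (forall k, `|x| <= dyadic k * C) -> x = 0.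
Proof.
move=> H; apply/eqP; rewrite -normr_le0; apply/ler_addgt0Pr => e e0.
have C1 : 0 < `|C| + 1 by rewrite ltr_wpDl.
have [k _ /(_ k (leqnn k)) /= Hk] := near_dyadic_le (divr_gt0 e0 C1).
apply: le_trans (H k) _; rewrite add0r.
apply: (@le_trans _ _ (dyadic k * (`|C| + 1))).
  by rewrite ler_pM2l ?dyadic_gt0 // (le_trans (ler_norm C)) // lerDl.
by rewrite -ler_pdivlMr.
Qed.

End dyadic.

Section derivative.
Variables (R : realType) (m : nat) (c : R) (G : R -> R).
Hypothesis G_max : shift_maximal m.+3 c G.

Let inc_ni (a b s : R) : b <= a -> 0 <= s -> G (a + s) - G a <= G (b + s) - G b.
Proof. exact: (increment_nonincreasing G_max). Qed.

Let inc_le_mul (u t : R) k : 0 <= t ->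
  G (u + t * k%:R) - G u <= (G (u + t) - G u) * k%:R.
Proof.
move=> t0; elim: k => [|k IH]; first by rewrite !mulr0 addr0 subrr.
have tk0 : 0 <= t * k%:R by rewrite mulr_ge0.
have -> : u + t * k.+1%:R = u + t * k%:R + t by rewrite -natr1; ring.
rewrite -natr1.
have : u <= u + t * k%:R by rewrite lerDl.
by move=> /inc_ni /(_ t0); lra.
Qed.

Let mul_le_inc (u t : R) k : 0 <= t ->
  (G (u + t * k%:R + t) - G (u + t * k%:R)) * k%:R <= G (u + t * k%:R) - G u.
Proof.
move=> t0; suff H j : (j <= k)%N -> (G (u + t * k%:R + t) - G (u + t * k%:R)) * j%:R
    <= G (u + t * j%:R) - G u by exact: H.
elim: j => [|j IH] jk; first by rewrite !mulr0 addr0 subrr.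
have -> : u + t * j.+1%:R = u + t * j%:R + t by rewrite -natr1; ring.
have := IH (ltnW jk); rewrite -[j.+1%:R]natr1.
have : u + t * j%:R <= u + t * k%:R.
  by rewrite lerD2l ler_wpM2l // ler_nat ltnW.
by move=> /inc_ni /(_ t0); lra.
Qed.

Let slope k u := (G (u + dyadic R k) - G u) * 2 ^+ k.

Let slope_dyadic k u : slope k u * dyadic R k = G (u + dyadic R k) - G u.
Proof. by rewrite /slope -mulrA [2 ^+ k * _]mulrC dyadic_mul mulr1. Qed.

Let slope_ni k (u v : R) : u <= v -> slope k v <= slope k u.
Proof.
by move=> uv; rewrite ler_pM2r ?exprn_gt0 // inc_ni // ltW // dyadic_gt0.
Qed.

Let slope_nd u : nondecreasing_seq (slope ^~ u).
Proof.
apply/nondecreasing_seqP => k.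
have := @inc_le_mul u (dyadic R k.+1) 2 (ltW (dyadic_gt0 R k.+1)).
rewrite mulr_natr mulr2n -dyadicS => H.
by rewrite /slope exprS mulrA ler_pM2r ?exprn_gt0.
Qed.

(** Beyond u + 2 ^- k the increments are smaller than those whose sum is
G (u + 2 ^- k) - G u. *)
Let slope_lag j k u : (k <= j)%N -> slope j (u + dyadic R k) <= slope k u.
Proof.
move=> kj; have := @mul_le_inc u (dyadic R j) (2 ^ (j - k))%N (ltW (dyadic_gt0 R j)).
have jk : (2 : R) ^+ j = (2 ^ (j - k))%N%:R * 2 ^+ k.
  by rewrite natrX -exprD subnK.
have -> : dyadic R j * (2 ^ (j - k))%N%:R = dyadic R k.
  rewrite /dyadic jk; field; rewrite expf_neq0 //.
  by rewrite pnatr_eq0 expn_eq0.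
by rewrite /slope jk mulrA ler_pM2r ?exprn_gt0.
Qed.

Let slope_le k u : slope k u <= G u - G (u - 1).
Proof.
have := @mul_le_inc (u - 1) (dyadic R k) (2 ^ k)%N (ltW (dyadic_gt0 R k)).
by rewrite natrX dyadic_mul subrK.
Qed.

Let slope_cvg u : cvgn (slope ^~ u).
Proof.
apply: nondecreasing_is_cvgn => //; exists (G u - G (u - 1)) => _ [k _ <-].
exact: slope_le.
Qed.

(** The right derivative of G along the steps 2 ^- k. *)
Let D u : R := limn (slope ^~ u).

Let slope_le_D k u : slope k u <= D u.
Proof.
exact: (nondecreasing_cvgn_le (@slope_nd u) (@slope_cvg u)).
Qed.

Let D_ni : {homo D : u v /~ u <= v}.
Proof.
move=> u v uv; apply: limr_le; first exact: slope_cvg.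
by near=> k; apply: le_trans (slope_le_D k v); exact: slope_ni.
Unshelve. all: by end_near. Qed.

Let D_le_slope k u : D (u + dyadic R k) <= slope k u.
Proof.
apply: limr_le; first exact: slope_cvg.
by near=> j; apply: slope_lag; near: j; exact: nbhs_infty_ge.
Unshelve. all: by end_near. Qed.

Let sum_D_le0 (u : 'I_m.+3 -> R) : \sum_i score c (u i) = 0 -> \sum_i D (u i) <= 0.
Proof.
move=> u0.
have cv : \sum_i slope k (u i) @[k --> \oo] --> \sum_i D (u i).
  by apply: cvg_big => [|i _]; [exact: add_continuous | exact: slope_cvg].
apply: (cvgr_to_le cv); near=> k.
rewrite -mulr_suml pmulr_lle0 ?exprn_gt0 // sumrB subr_le0 ltW // G_max //.
by rewrite gt_eqF // dyadic_gt0.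
Unshelve. all: by end_near. Qed.

(** The increment of G that ends at w i is at most the one that starts at u i, if
the step is shorter than w i - u i. *)
Let sum_D_ge0 (u w : 'I_m.+3 -> R) : (forall i, u i < w i) ->
  \sum_i score c (w i) = 0 -> 0 <= \sum_i D (u i).
Proof.
move=> uw w0.
have [k _ /(_ k (leqnn k)) /= Hk] :
    \forall k \near \oo, forall i, dyadic R k <= w i - u i.
  by apply: filter_forall => i; apply: near_dyadic_le; rewrite subr_gt0.
have k0 := dyadic_gt0 R k.
apply: (@le_trans _ _ (\sum_i slope k (u i))); last exact: ler_sum.
rewrite -mulr_suml pmulr_lge0 ?exprn_gt0 //.
have : 0 <= \sum_i (G (w i) - G (w i - dyadic R k)).
  rewrite sumrB subr_ge0 ltW // G_max // oppr_eq0 gt_eqF //.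
move=> /le_trans; apply; apply: ler_sum => i _.
have := @inc_ni (w i - dyadic R k) (u i) (dyadic R k).
by rewrite subrK; apply; [have := Hk i; lra | exact: ltW].
Qed.

(** D, as a function of the score, satisfies the sign conditions of
sum_sign_linear, whence D = - d score.  Then F = G + d Phi moves over a dyadic
step t by at most d t times the variation of the score over that step; the sum
of these bounds telescopes and tends to 0 with t, so F is invariant under
dyadic translations.  Real translations follow on the right of the mode u0,
where G is monotone, and an integer translation brings any point there. *)
Lemma shift_maximal_shape : exists C d, 0 < d /\
  forall u, G u = C - d * (expR u + expR (- u) - 2 * c * u).
Proof.
have [L LK scoreK] := score_bij c.
have L_mono : {mono L : x y / x <= y}.
  by move=> x y; rewrite -[in RHS](LK x) -[in RHS](LK y) score_le.
have [d d0 DL] : exists2 d, 0 <= d & forall v, D (L v) = - (d * v).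
  apply: (@sum_sign_linear R m (D \o L)).
  - by move=> x y xy /=; apply: D_ni; rewrite L_mono.
  - move=> v v0; apply: sum_D_le0; rewrite -[RHS]v0.
    by apply: eq_bigr => i _; rewrite LK.
  - move=> v v0.
    (* Raise every v i by the same amount to make the sum vanish. *)
    apply: (@sum_D_ge0 _ (fun i => L (v i - (\sum_i v i) / m.+3%:R))).
      by move=> i; rewrite (leW_mono L_mono) ltrDl oppr_gt0 pmulr_llt0 ?invr_gt0.
    under eq_bigr do rewrite LK.
    rewrite big_split/= sumr_const card_ord mulNrn.
    rewrite -(mulr_natr (_ / _)) divfK ?subrr //.
have DE u : D u = - (d * score c u) by rewrite -{1}(scoreK u) DL.
pose Phi (u : R) := expR u + expR (- u) - 2 * c * u.
pose F u := G u + d * Phi u.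
have Phi_inc (u t : R) : 0 <= t ->
    score c u * t <= Phi (u + t) - Phi u <= score c (u + t) * t.
  move=> t0; rewrite /Phi /score opprD !expRD.
  have e1 := expR_ge1Dx t; have e2 := expR_ge1Dx (- t).
  have e3 := expR_gt0 u; have e4 := expR_gt0 (- u).
  have e5 := expR_gt0 t; have e6 := expR_gt0 (- t).
  have e7 : expR t * expR (- t) = 1 by rewrite expRN divff // gt_eqF.
  have h1 : 0 <= expR u * (expR t - (1 + t)) by apply: mulr_ge0; lra.
  have h2 : 0 <= expR (- u) * (expR (- t) - (1 - t)) by apply: mulr_ge0; lra.
  have h3 : 0 <= expR u * (expR t * (expR (- t) - (1 - t))).
    by rewrite !mulr_ge0 ?expR_ge0 //; lra.
  have h4 : 0 <= expR (- u) * (expR (- t) * (expR t - (1 + t))).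
    by rewrite !mulr_ge0 ?expR_ge0 //; lra.
  rewrite ![_ * (_ - (_ - _))]mulrBr e7 in h3.
  rewrite ![_ * (_ - (_ + _))]mulrBr [expR (- t) * expR t]mulrC e7 in h4.
  by apply/andP; split; lra.
have F_inc k u : `|F (u + dyadic R k) - F u|
    <= dyadic R k * (d * (score c (u + dyadic R k) - score c u)).
  have k0 := dyadic_gt0 R k; have /andP[p1 p2] := Phi_inc u _ (ltW k0).
  have s1 : G (u + dyadic R k) - G u <= - (d * score c u) * dyadic R k.
    by rewrite -slope_dyadic ler_pM2r // -DE.
  have s2 : - (d * score c (u + dyadic R k)) * dyadic R k
      <= G (u + dyadic R k) - G u.
    by rewrite -slope_dyadic ler_pM2r // -DE.
  have q1 := ler_wpM2l d0 p1; have q2 := ler_wpM2l d0 p2.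
  by rewrite ler_norml /F; apply/andP; split; lra.
have F_inc_mul k j u : `|F (u + dyadic R k * j%:R) - F u|
    <= dyadic R k * (d * (score c (u + dyadic R k * j%:R) - score c u)).
  elim: j => [|j IH]; first by rewrite mulr0 addr0 !subrr normr0 !mulr0.
  have -> : u + dyadic R k * j.+1%:R = u + dyadic R k * j%:R + dyadic R k.
    by rewrite -natr1; ring.
  have := F_inc k (u + dyadic R k * j%:R); move: IH.
  set x := F (u + dyadic R k * j%:R); set y := F (_ + dyadic R k) => h1 h2.
  rewrite (_ : y - F u = (y - x) + (x - F u)); last by lra.
  by apply: le_trans (ler_normD _ _) _; lra.
pose u0 := L 0.
have su0 : score c u0 = 0 by rewrite LK.
have G_u0 (t : R) : t != 0 -> G (u0 + t) < G u0.
  move=> t0; have := @G_max (fun=> u0) t.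
  rewrite !sumr_const card_ord su0 mul0rn => /(_ erefl t0).
  by rewrite ltrMn2r.
have G_ni (u v : R) : u0 <= u -> u <= v -> G v <= G u.
  move=> u0u uv; have vu : 0 <= v - u by rewrite subr_ge0.
  have := inc_ni u0u vu; rewrite [u + _]addrC subrK.
  have [->|ne] := eqVneq (v - u) 0; first by rewrite addr0; lra.
  by have := G_u0 _ ne; lra.
(* w is the last point before v reached from u by dyadic steps. *)
have F_right (u v : R) : u0 <= u -> u <= v -> F v = F u.
  move=> u0u uv; apply/eqP; rewrite -subr_eq0; apply/eqP.
  apply: (@le_dyadic_eq0 _ _ (d * (score c v + score c (v + 1)))) => k.
  have k0 := dyadic_gt0 R k.
  have vuk : 0 <= (v - u) * 2 ^+ k by rewrite mulr_ge0 ?exprn_ge0 // subr_ge0.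
  have vukE : dyadic R k * ((v - u) * 2 ^+ k) = v - u.
    by rewrite mulrCA dyadic_mul mulr1.
  have /andP[] := truncn_itv vuk; set j := Num.truncn _.
  rewrite -(ler_pM2l k0) -(ltr_pM2l k0) vukE -natr1 => wv vw.
  have := F_inc_mul k j u; set w := u + dyadic R k * j%:R => Fw.
  have uw : u <= w by rewrite lerDl mulr_ge0 // ltW.
  have k1 : dyadic R k <= 1.
    by rewrite /dyadic invf_le1 ?exprn_gt0 // exprn_ege1 // ler1n.
  have [wv' vw'] : w <= v /\ v <= w + dyadic R k by rewrite /w; split; lra.
  have /andP[p1 p2] : score c w * (v - w) <= Phi v - Phi w <= score c v * (v - w).
    by have := @Phi_inc w (v - w); rewrite [w + _]addrC subrK; apply; lra.
  have g1 : G v <= G w by apply: G_ni => //; exact: le_trans uw.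
  have g2 : G (w + dyadic R k) <= G v by apply: G_ni => //; lra.
  have g3 : - (d * score c (w + dyadic R k)) * dyadic R k
      <= G (w + dyadic R k) - G w.
    by rewrite -slope_dyadic ler_pM2r // -DE.
  have sge (x y : R) : x <= y -> score c x <= score c y by rewrite score_le.
  have s0 : 0 <= score c u by rewrite -su0 sge.
  have s1 := sge _ _ uw; have s2 := sge _ _ wv'.
  have s3 : score c (w + dyadic R k) <= score c (v + 1) by apply: sge; lra.
  have r1 : 0 <= score c w * (v - w) by apply: mulr_ge0; lra.
  have r2 : score c v * (v - w) <= score c v * dyadic R k.
    by rewrite ler_wpM2l //; lra.
  have q1 : 0 <= d * (Phi v - Phi w) by apply: mulr_ge0 => //; lra.
  have q2 : d * (Phi v - Phi w) <= d * (score c v * dyadic R k).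
    by rewrite ler_wpM2l //; lra.
  have q3 : d * score c (w + dyadic R k) * dyadic R k
      <= d * score c (v + 1) * dyadic R k.
    by rewrite ler_pM2r // ler_wpM2l.
  have q4 : dyadic R k * (d * (score c w - score c u))
      <= dyadic R k * (d * score c v).
    by rewrite ler_pM2l // ler_wpM2l //; lra.
  have q5 : dyadic R k * (d * score c v) <= dyadic R k * (d * score c (v + 1)).
    by rewrite ler_pM2l // ler_wpM2l // sge // lerDl.
  move: Fw => /le_trans /(_ q4); rewrite !ler_norml /F => /andP[f1 f2].
  by apply/andP; split; lra.
have F_period u j : F (u + j%:R) = F u.
  apply/eqP; rewrite -subr_eq0; apply/eqP.
  apply: (@le_dyadic_eq0 _ _ (d * (score c (u + j%:R) - score c u))) => k.
  have := F_inc_mul k (2 ^ k * j)%N u.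
  by rewrite natrM natrX mulrA dyadic_mul mul1r.
have F_const u : F u = F u0.
  have [u0u|uu0] := leP u0 u; first exact: F_right.
  have := truncnS_gt (u0 - u); set j := (Num.truncn _).+1 => jP.
  transitivity (F (u + j%:R)); first by rewrite F_period.
  by apply: F_right; lra.
exists (F u0), d; split.
  rewrite lt_neqAle d0 andbT; apply/eqP => dE.
  have := G_u0 1 (oner_neq0 _); have := F_const (u0 + 1).
  by rewrite /F -dE !mul0r !addr0 => ->; rewrite ltxx.
by move=> u; rewrite -(F_const u) /F addrK.
Qed.

End derivative.

(** * The normalising constant of the GIG density *)

Section inversion.
Variables (R : realType) (r : R).
Hypothesis r0 : 0 < r.
Let mu := @lebesgue_measure R.
Let I (k : nat) := `[r / k.+1%:R, r * k.+1%:R]%classic.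

Let I_gt0 k x : I k x -> 0 < x.
Proof.
rewrite /I/= in_itv/= => /andP[+ _]; apply: lt_le_trans.
by rewrite divr_gt0.
Qed.

Let I_nondecreasing : nondecreasing_seq I.
Proof.
apply/nondecreasing_seqP => k; rewrite subsetEset => x; rewrite /I/=.
rewrite !in_itv/= => /andP[h1 h2]; apply/andP; split.
  by apply: le_trans h1; rewrite ler_pM2l // lef_pV2 ?posrE // ler_nat.
by apply: le_trans h2 _; rewrite ler_pM2l // ler_nat.
Qed.

Let bigcup_I : \bigcup_k I k = `]0, +oo[%classic.
Proof.
apply/seteqP; split => x /=.
  by move=> [k _ /I_gt0 x0]; rewrite in_itv/= x0.
rewrite in_itv/= andbT => x0.
exists (Num.truncn (x / r + r / x)); first by [].
rewrite /I/= in_itv/=.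
have := truncnS_gt (x / r + r / x); set K := _.+1%:R => xK.
have K0 : 0 < K by rewrite ltr0Sn.
rewrite ler_pdivrMr // -ler_pdivrMl // mulrC -ler_pdivrMl // mulrC.
rewrite [r^-1 * x]mulrC.
have h1 : 0 < x / r by rewrite divr_gt0.
have h2 : 0 < r / x by rewrite divr_gt0.
apply/andP; split; lra.
Qed.

(** The substitution x = r ^ 2 / y maps each of the compact intervals from r / k
to r k onto itself; these intervals exhaust the half-line. *)
Lemma ge0_integral_inversion (g : R -> R) :
  (forall x : R, 0 < x -> {for x, continuous g}) ->
  (forall x : R, 0 < x -> 0 <= g x) ->
  (\int[mu]_(x in `]0%R, +oo[) (g x)%:E =
   \int[mu]_(x in `]0%R, +oo[) (g (r ^+ 2 / x) * (r ^+ 2 / x ^+ 2))%:E)%E.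
Proof.
move=> cg g0.
pose F (x : R) := r ^+ 2 / x.
have F_gt0 (x : R) : 0 < x -> 0 < F x by move=> x0; rewrite divr_gt0 // exprn_gt0.
have dF (x : R) : 0 < x -> is_derive x 1 F (- (r ^+ 2 / x ^+ 2)).
  move=> x0; have xn0 : x != 0 by rewrite gt_eqF.
  have := @is_deriveV R id x 1 1 xn0 (is_derive_id _ _).
  move=> /(@is_deriveZ _ _ _ _ (r ^+ 2) _ _).
  by rewrite /F /GRing.scale/= mulr1 -mulrN.
have F'E (x : R) : 0 < x -> derive1 F x = - (r ^+ 2 / x ^+ 2).
  by move=> x0; rewrite derive1E; exact: @derive_val _ _ _ _ _ _ _ (dF x x0).
have ch (x : R) : 0 < x -> {for x, continuous (fun y : R => r ^+ 2 / y ^+ 2)}.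
  move=> x0; apply: continuousM; first exact: cst_continuous.
  apply: continuousV; first by rewrite expf_neq0 // gt_eqF.
  exact: exprn_continuous.
have cF' (x : R) : 0 < x -> {for x, continuous (derive1 F)}.
  move=> x0; apply: (@cvg_trans _ ((fun y : R => - (r ^+ 2 / y ^+ 2)) @ x)).
    apply: near_eq_cvg; near=> y; rewrite F'E //; near: y; exact: lt_nbhsr.
  by rewrite F'E //; exact: (continuousN (ch x x0)).
have cF (x : R) : 0 < x -> {for x, continuous F}.
  move=> x0; apply/differentiable_continuous/derivable1_diffP.
  by have [] := dF x x0.
have step k : (\int[mu]_(x in I k) (g x)%:E =
   \int[mu]_(x in I k) (g (F x) * (r ^+ 2 / x ^+ 2))%:E)%E.
  have k0 : 0 < k.+1%:R :> R by [].
  have a0 : 0 < r / k.+1%:R by rewrite divr_gt0.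
  have b0 : 0 < r * k.+1%:R by rewrite mulr_gt0.
  have Fa : F (r / k.+1%:R) = r * k.+1%:R by rewrite /F; field; rewrite !gt_eqF.
  have Fb : F (r * k.+1%:R) = r / k.+1%:R by rewrite /F; field; rewrite !gt_eqF.
  have ab : r / k.+1%:R <= r * k.+1%:R.
    by rewrite ler_pM2l // (@le_trans _ _ 1) ?invf_le1 // ler1n.
  have := @integration_by_substitution_decreasing R F g _ _ ab.
  rewrite Fa Fb => -> //.
  - apply: eq_integral => x; rewrite inE => /I_gt0 x0.
    by rewrite /= !fctE/= F'E // opprK.
  - move=> x y; rewrite !in_itv/= => /andP[ax _] /andP[ay _] xy.
    rewrite /F ltr_pM2l ?exprn_gt0 // ltf_pV2 // posrE; exact: lt_le_trans a0 _.
  - move=> x; rewrite in_itv/= => /andP[ax _]; apply: cF'; exact: lt_trans ax.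
  - apply: cvgP; apply: cvg_at_right_filter; exact: cF'.
  - apply: cvgP; apply: cvg_at_left_filter; exact: cF'.
  - split.
    + move=> x; rewrite in_itv/= => /andP[ax _].
      by have [] := dF x (lt_trans a0 ax).
    + apply: cvg_at_right_filter; exact: cF.
    + apply: cvg_at_left_filter; exact: cF.
  - apply: continuous_in_subspaceT => x; rewrite inE => /I_gt0; exact: cg.
have lim_int (h : R -> R) : (forall x : R, 0 < x -> {for x, continuous h}) ->
    (forall x : R, 0 < x -> 0 <= h x) ->
    (limn (fun k => \int[mu]_(x in I k) (h x)%:E) =
     \int[mu]_(x in `]0%R, +oo[) (h x)%:E)%E.
  move=> ctsh h0; rewrite -bigcup_I; apply/cvg_lim; first exact: ereal_hausdorff.
  apply: ge0_nondecreasing_set_cvg_integral => //.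
  - by move=> k; exact: measurable_itv.
  - move=> k; apply/measurable_EFinP.
    apply: subspace_continuous_measurable_fun; first exact: measurable_itv.
    by apply: continuous_in_subspaceT => x; rewrite inE => /I_gt0; exact: ctsh.
  - by move=> k x /I_gt0 x0; rewrite lee_fin h0.
rewrite -lim_int // (funext step) lim_int // => x x0.
- apply: (@continuousM _ _ (g \o F)); last exact: ch.
  by apply: continuous_comp; [exact: cF | exact/cg/F_gt0].
- by rewrite mulr_ge0 ?g0 ?F_gt0 // divr_ge0 // sqr_ge0.
Unshelve. all: by end_near. Qed.

End inversion.

Definition gig_kernel (R : realType) (q z x : R) : R :=
  x `^ (q - 1) * expR (- (z * (x + x^-1) / 2)).

Section bessel.
Variable R : realType.
Implicit Types (f : R -> R) (q z x K : R).

Lemma powR_expR x q : 0 < x -> x `^ q = expR (q * ln x).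
Proof. by move=> x0; rewrite /powR gt_eqF. Qed.

Lemma continuous_powR q x : 0 < x -> {for x, continuous (@powR R ^~ q)}.
Proof.
move=> x0; apply/differentiable_continuous/derivable1_diffP.
by have [] := is_derive1_powR q x0.
Qed.

Lemma gig_kernel_gt0 q z x : 0 < x -> 0 < gig_kernel q z x.
Proof. by move=> x0; rewrite mulr_gt0 ?powR_gt0 ?expR_gt0. Qed.

Lemma continuous_gig_kernel q z x : 0 < x -> {for x, continuous (gig_kernel q z)}.
Proof.
move=> x0; apply: continuousM; first exact: continuous_powR.
apply: (@continuous_comp _ _ _ (fun x => - (z * (x + x^-1) / 2)) expR).
  apply: continuousN; apply: continuousM; last exact: cst_continuous.
  apply: continuousM; first exact: cst_continuous.
  apply: continuousD; first by [].
  by apply: continuousV => //; rewrite gt_eqF.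
exact: continuous_expR.
Qed.

(** Substituting x = (z / 2) / y in the integral that defines the Bessel
function yields the GIG kernel in y. *)
Lemma besselK_gig_kernel q z j : 0 < z ->
  (\int[lebesgue_measure]_(x in `]0%R, +oo[) (gig_kernel q z x)%:E = j%:E)%E ->
  besselK q z = j / 2.
Proof.
move=> z0 Ej.
pose g x : R := x `^ (- q - 1) * expR (- x - z ^+ 2 / (4 * x)).
have z2 : 0 < z / 2 by rewrite divr_gt0.
have r0 : 0 < Num.sqrt (z / 2) by rewrite sqrtr_gt0.
have := @ge0_integral_inversion R _ r0 g.
have -> : (\int[lebesgue_measure]_(x in `]0%R, +oo[)
    (g (Num.sqrt (z / 2) ^+ 2 / x) * (Num.sqrt (z / 2) ^+ 2 / x ^+ 2))%:E =
    ((z / 2) `^ (- q) * j)%:E)%E.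
  rewrite EFinM -Ej -ge0_integralZl //.
  - apply: eq_integral => x; rewrite inE/= in_itv/= andbT => x0.
    rewrite -EFinM; congr EFin.
    rewrite sqr_sqrtr ?ltW // /g /gig_kernel !powR_expR ?divr_gt0 //.
    have -> : z / 2 / x ^+ 2 = expR (ln (z / 2) - 2 * ln x).
      rewrite expRB lnK ?posrE // mulr_natl -lnXn // lnK // posrE exprn_gt0 //.
    rewrite -!expRD; congr expR.
    rewrite [ln (z / 2 / x)]ln_div ?posrE //; field.
    by rewrite !gt_eqF.
  - apply/measurable_EFinP; apply: subspace_continuous_measurable_fun.
      exact: measurable_itv.
    apply: continuous_in_subspaceT => x; rewrite inE/= in_itv/= andbT.
    exact: continuous_gig_kernel.
  - move=> x; rewrite /= in_itv/= andbT => x0.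
    by rewrite lee_fin ltW // gig_kernel_gt0.
  - by rewrite lee_fin powR_ge0.
rewrite /besselK /Rintegral => ->.
- rewrite /= !powR_expR // mulrA -!expRD ln_div ?posrE //.
  rewrite mulrC; congr (_ * _).
  have -> : (- q - 1) * ln 2 + q * ln z + - q * (ln z - ln 2) = - ln 2 :> R by ring.
  by rewrite expRN lnK // posrE.
- move=> x x0; apply: continuousM; first exact: continuous_powR.
  apply: (@continuous_comp _ _ _ (fun x => - x - z ^+ 2 / (4 * x)) expR).
    apply: continuousB; first by apply: continuousN.
    apply: continuousM; first exact: cst_continuous.
    apply: continuousV; first by rewrite gt_eqF // mulr_gt0.
    by apply: continuousM => //; exact: cst_continuous.
  exact: continuous_expR.
- by move=> x x0; rewrite mulr_ge0 ?powR_ge0 ?expR_ge0.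
Qed.

(** A density determines its own normalising constant, so K must be the constant
of the GIG density; the finiteness of the integral of the kernel comes from
that of f. *)
Lemma scale_family_gig_kernel f q z K : 0 < z -> 0 < K -> is_density_pos f ->
  (forall x, 0 < x -> f x = K * gig_kernel q z x) ->
  same_family (scale_family f) (gig_density_scale q z).
Proof.
move=> z0 K0 [mf f0 f1] fE.
have BK : besselK q z = K^-1 / 2.
  apply: besselK_gig_kernel => //.
  have KV0 : 0 <= K^-1 by rewrite invr_ge0 ltW.
  rewrite -[RHS]mule1 -f1 -ge0_integralZl //.
  - apply: eq_integral => x; rewrite inE/= in_itv/= andbT => x0.
    by rewrite -EFinM fE // mulrA mulVf ?mul1r // gt_eqF.
  - exact/measurable_EFinP.
  - by move=> x; rewrite /= in_itv/= andbT => x0; rewrite lee_fin f0.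
move=> eta x eta0 x0; rewrite /scale_family /gig_density_scale fE ?divr_gt0 //.
rewrite /gig_kernel BK invf_div.
field; rewrite !gt_eqF //.
Qed.

Lemma gig_density_scaleE q z (eta : R) x : 0 < eta -> 0 < z -> 0 < x ->
  gig_density_scale q z eta x = gig_density q (z / eta) (eta * z) x.
Proof.
move=> eta0 z0 x0; rewrite /gig_density_scale /gig_density.
have -> : z / eta / (eta * z) = eta ^- 2 by field; rewrite !gt_eqF.
have -> : z / eta * (eta * z) = z ^+ 2 by field; rewrite gt_eqF.
rewrite sqrtr_sqr (gtr0_norm z0) !powR_expR ?divr_gt0 ?invr_gt0 ?exprn_gt0 //.
rewrite lnV ?posrE ?exprn_gt0 // lnXn // ln_div ?posrE //.
move: (besselK q z) => B.
have -> : z / eta * x + eta * z / x = z * (x / eta + eta / x) by ring.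
set E := expR (- _).
have -> : (q - 1) * (ln x - ln eta) =
    (q / 2 * - (ln eta *+ 2)) + (q - 1) * ln x + ln eta.
  by field.
rewrite !expRD lnK ?posrE // !invfM; set E1 := expR _; set E2 := expR _.
by move: B^-1 => b; field; rewrite gt_eqF.
Qed.

End bessel.

(** * Likelihood and estimator *)

Section likelihood.
Variable R : realType.
Implicit Types (p theta : R) (f : R -> R).

Section estimator.
Variables (n : nat) (p theta : R) (u : 'I_n.+1 -> R).
Hypothesis theta0 : 0 < theta.
Let X i := expR (u i).
Let M := sample_mean X.
Let H := sample_mean_inv X.

Let sum_expR_gt0 (s : R) : 0 < \sum_i expR (s * u i).
Proof.
by rewrite big_ord_recl ltr_pwDl ?expR_gt0 // sumr_ge0 // => i _; exact: expR_ge0.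
Qed.

Let M_gt0 : 0 < M.
Proof.
rewrite mulr_gt0 ?invr_gt0 //; have := sum_expR_gt0 1.
by under eq_bigr do rewrite mul1r.
Qed.

Let H_gt0 : 0 < H.
Proof.
rewrite mulr_gt0 ?invr_gt0 //; have := sum_expR_gt0 (- 1).
by under eq_bigr do rewrite mulN1r expRN.
Qed.

Let MH_gt0 : 0 < theta ^+ 2 * M * H.
Proof. exact: mulr_gt0 (mulr_gt0 (exprn_gt0 2 theta0) M_gt0) H_gt0. Qed.

Lemma gig_estimator_gt0 : 0 < gig_estimator p theta X.
Proof.
rewrite /gig_estimator -/M -/H; apply: divr_gt0; last exact: mulr_gt0.
rewrite subr_gt0.
apply: le_lt_trans (ler_norm p) _; rewrite -sqrtr_sqr ltr_sqrt ?ltrDl //.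
by rewrite ltr_wpDl // sqr_ge0.
Qed.

(** The estimator is the positive root of theta H t ^ 2 + 2 p t - theta M. *)
Let estimator_equation t : 0 < t ->
  gig_estimator p theta X = t <-> theta * M = 2 * p * t + theta * H * t ^+ 2.
Proof.
move=> t0; rewrite /gig_estimator -/M -/H.
have th0 : 0 < theta * H by rewrite mulr_gt0.
have D0 : 0 <= p ^+ 2 + theta ^+ 2 * M * H.
  by rewrite addr_ge0 ?sqr_ge0 // ltW.
have s2 := sqr_sqrtr D0; split => [tE|tE].
  have sE : Num.sqrt (p ^+ 2 + theta ^+ 2 * M * H) = p + theta * H * t.
    by rewrite -tE; field; rewrite !gt_eqF.
  rewrite sE in s2; apply: (mulIf (lt0r_neq0 th0)); move: s2; lra.
have -> : p ^+ 2 + theta ^+ 2 * M * H = (p + theta * H * t) ^+ 2.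
  have -> : theta ^+ 2 * M * H = theta * H * (theta * M) by ring.
  by rewrite tE; ring.
have tM : 0 < theta * M by rewrite mulr_gt0.
have tH : 0 < theta * H * t by rewrite mulr_gt0.
have p0 : 0 < p + theta * H * t.
  rewrite -(pmulr_lgt0 _ t0); have : 0 < theta * H * t * t by rewrite mulr_gt0.
  lra.
by rewrite sqrtr_sqr gtr0_norm //; field; rewrite !gt_eqF.
Qed.

Lemma gig_estimator_expR (tau : R) : gig_estimator p theta X = expR tau <->
  \sum_i score (p / theta) (u i - tau) = 0.
Proof.
rewrite estimator_equation ?expR_gt0 //.
have -> : \sum_i score (p / theta) (u i - tau) =
    n.+1%:R * (M / expR tau - H * expR tau - 2 * (p / theta)).
  rewrite /M /H /sample_mean /sample_mean_inv /score !sumrB sumr_const card_ord.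
  rewrite !mulrBr !mulrA divff ?pnatr_eq0 // !mul1r.
  congr (_ - _ - _); last by rewrite -[LHS]mulr_natl !mulrA.
  - by rewrite mulr_suml; apply: eq_bigr => i _; rewrite expRB.
  - by rewrite mulr_suml; apply: eq_bigr => i _; rewrite opprB expRB mulrC.
have t0 := expR_gt0 tau; move: (expR tau) t0 => t t0.
have -> : M / t - H * t - 2 * (p / theta) =
    (theta * M - (2 * p * t + theta * H * t ^+ 2)) / (theta * t).
  by field; rewrite !gt_eqF.
split=> [->|/eqP]; first by rewrite subrr mul0r mulr0.
rewrite !mulf_eq0 invr_eq0 pnatr_eq0 mulf_eq0 (gt_eqF theta0) (gt_eqF t0) !orbF.
by rewrite subr_eq0 => /eqP.
Qed.

End estimator.

(** Evaluated at expR tau, the likelihood of the sample expR (u i) is the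
exponential of the sum of the G (u i - tau), up to a factor that does not
depend on tau. *)
Lemma is_MLE_scale_family n p theta f (G : R -> R) : 0 < theta ->
  (forall u, f (expR u) = expR (G u - u)) ->
  is_MLE (scale_family f) (@gig_estimator R n.+1 p theta) <->
  shift_maximal n.+1 (p / theta) G.
Proof.
move=> theta0 fG.
have likE (u : 'I_n.+1 -> R) tau :
    likelihood (scale_family f) (fun i => expR (u i)) (expR tau) =
    expR (\sum_i G (u i - tau) - \sum_i u i).
  rewrite /likelihood /scale_family -sumrB expR_sum; apply: eq_bigr => i _.
  by rewrite -expRB fG -expRN -expRD; congr expR; ring.
split=> [mle u t u0 t0|Gmax X X0].
  have := (mle (fun i => expR (u i)) (fun i => expR_gt0 (u i))).2 (expR (- t)).
  have -> : gig_estimator p theta (fun i => expR (u i)) = expR 0.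
    apply/gig_estimator_expR => //; rewrite -[RHS]u0.
    by apply: eq_bigr => i _; rewrite subr0.
  rewrite expR_gt0 (inj_eq (@expR_inj R)) oppr_eq0 => /(_ isT t0).
  rewrite !likE ltr_expR ltrD2r.
  by under eq_bigr do rewrite opprK; under [ltRHS]eq_bigr do rewrite subr0.
have {X0} [u ->] : exists u, X = (fun i => expR (u i)).
  by exists (fun i => ln (X i)); apply/funext => i; rewrite lnK // posrE.
have T0 := gig_estimator_gt0 p u theta0; split => // eta eta0.
have TE := lnK T0; move: (ln _) TE => tau TE.
have /gig_estimator_expR tauE := esym TE.
rewrite -(lnK eta0) -TE (inj_eq (@expR_inj R)) => ne.
rewrite !likE ltr_expR ltrD2r.
have := Gmax _ (tau - ln eta) (tauE theta0).
rewrite subr_eq0 eq_sym => /(_ ne).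
by under eq_bigr do rewrite addrA subrK.
Qed.

(** The maximal likelihood of a sample is positive, being larger than another
value of the likelihood.  Any x is an observation of some sample whose estimate
is 1: complete it by the observation of opposite score and by zero scores. *)
Lemma is_MLE_density_gt0 m p theta f : 0 < theta ->
  (forall x, 0 < x -> 0 <= f x) ->
  is_MLE (scale_family f) (@gig_estimator R m.+3 p theta) ->
  forall x, 0 < x -> 0 < f x.
Proof.
move=> theta0 f0 mle x x0.
have [L LK _] := score_bij (p / theta).
pose u (i : 'I_m.+3) := nth (L 0) [:: ln x; L (- score (p / theta) (ln x)); L 0] i.
have := (mle (fun i => expR (u i)) (fun i => expR_gt0 (u i))).2 2.
have -> : gig_estimator p theta (fun i => expR (u i)) = 1.
  rewrite -expR0; apply/gig_estimator_expR => //.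
  under eq_bigr do rewrite subr0.
  by rewrite (sum_three m (score _)) !LK mul0rn subrr !addr0.
have -> : (2 != 1 :> R) by rewrite (eqr_nat R 2 1).
move=> /(_ ltac:(lra) isT) lt.
have lik0 : 0 <= likelihood (scale_family f) (fun i => expR (u i)) 2.
  apply: prodr_ge0 => i _.
  by rewrite mulr_ge0 // f0 // divr_gt0 ?expR_gt0.
rewrite lt_neqAle f0 // andbT; apply/eqP => fx0.
have := le_lt_trans lik0 lt; rewrite /likelihood big_ord_recl.
by rewrite /scale_family invr1 mul1r mulr1 /u /= lnK // -fx0 mul0r ltxx.
Qed.

Lemma gig_kernel_expR p theta d C u : theta != 0 ->
  expR C * gig_kernel (p * d) (theta * d) (expR u) =
  expR (C - theta * d / 2 * (expR u + expR (- u) - 2 * (p / theta) * u) - u).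
Proof.
move=> theta0; rewrite /gig_kernel powR_expR ?expR_gt0 // expRK -expRN -!expRD.
by congr expR; field.
Qed.

(** The primitive of the score lies strictly above its tangents, and the slopes
of the tangents at the u i add up to 0. *)
Lemma score_primitive_maximal n (c C a : R) : 0 < a ->
  shift_maximal n.+1 c (fun u => C - a * (expR u + expR (- u) - 2 * c * u)).
Proof.
move=> a0 u t u0 t0; rewrite -subr_gt0 -sumrB.
apply: (@le_lt_trans _ _ (\sum_i a * t * score c (u i))).
  by rewrite -mulr_sumr u0 mulr0.
apply: ltr_sum; first by apply/hasP; exists ord0; rewrite ?mem_index_enum.
move=> i _; rewrite /score [- (_ + t)]opprD !expRD.
have e1 : 0 < expR t - (1 + t) by rewrite subr_gt0 expR_gt1Dx.
have e2 : 0 < expR (- t) - (1 - t) by rewrite subr_gt0 expR_gt1Dx // oppr_eq0.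
have h1 := mulr_gt0 a0 (mulr_gt0 (expR_gt0 (u i)) e1).
have h2 := mulr_gt0 a0 (mulr_gt0 (expR_gt0 (- u i)) e2).
lra.
Qed.

End likelihood.

(** * The characterization *)

Theorem theorem3p1 (R : realType) (n : nat) (p theta : R) (f : R -> R)
    (hn : (3 <= n)%N) (htheta : 0 < theta) (hf : is_density_pos f) :
  (is_MLE (scale_family f) (@gig_estimator R n p theta) <->
   exists d : R, 0 < d /\
     same_family (scale_family f) (gig_density_scale (p * d) (theta * d)))
  /\
  (forall d : R, 0 < d ->
     same_family (gig_density_scale (p * d) (theta * d))
       (fun eta => gig_density (p * d) (theta * d / eta) (theta * eta * d))).
Proof.
split; last first.
  move=> d d0 eta x eta0 x0; rewrite gig_density_scaleE ?mulr_gt0 //.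
  by have -> : theta * eta * d = eta * (theta * d) by ring.
case: n hn => [//|[//|[//|m _]]].
have [_ f0 f1] := hf; split=> [mle|[d [d0 same]]].
  have f_gt0 := is_MLE_density_gt0 htheta f0 mle.
  pose G u := ln (f (expR u)) + u.
  have fG u : f (expR u) = expR (G u - u).
    by rewrite /G addrK lnK // posrE f_gt0 // expR_gt0.
  have [C [a [a0 GE]]] :=
    shift_maximal_shape ((is_MLE_scale_family m.+2 p htheta fG).1 mle).
  exists (2 * a / theta); rewrite divr_gt0 ?mulr_gt0 //; split => //.
  apply: (@scale_family_gig_kernel _ _ _ _ (expR C)) => //.
  - by rewrite mulr_gt0 // divr_gt0 // mulr_gt0.
  - exact: expR_gt0.
  move=> x x0; rewrite -[x](lnK x0) gig_kernel_expR ?gt_eqF // fG GE.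
  by have -> : theta * (2 * a / theta) / 2 = a by field; rewrite gt_eqF.
pose K := (2 * besselK (p * d) (theta * d))^-1.
have fE x : 0 < x -> f x = K * gig_kernel (p * d) (theta * d) x.
  move=> x0; have := same 1 x ltr01 x0.
  rewrite /scale_family /gig_density_scale /gig_kernel invr1 !mulr1 !mul1r => ->.
  by rewrite -mulrA.
have K0 : 0 < K.
  rewrite lt_neqAle; apply/andP; split; last first.
    have := f0 1 ltr01; rewrite fE // pmulr_lge0 //; exact: gig_kernel_gt0.
  apply/eqP => KE; move: f1.
  rewrite (eq_integral (fun=> 0%E)) ?integral0.
    by move=> /eqP; rewrite eq_sym onee_eq0.
  by move=> x; rewrite inE/= in_itv/= andbT => x0; rewrite fE // -KE mul0r.
apply/(@is_MLE_scale_family _ _ _ _ _ (fun u => ln K - theta * d / 2 *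
  (expR u + expR (- u) - 2 * (p / theta) * u)) htheta).
  by move=> u; rewrite fE ?expR_gt0 // -[K in LHS](lnK K0) gig_kernel_expR // gt_eqF.
by apply: score_primitive_maximal; rewrite divr_gt0 ?mulr_gt0.
Qed.
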